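(* Let $n$ be a positive integer and let $p_1,\dots,p_n$ be $n$ distinct prime numbers. Let $(X,r)$ be an indecomposable solution of the Yang–Baxter equation with $|X|=p_1\cdots p_n$. Then $(X,r)$ is a multipermutation solution. In particular, if $n>1$, then $(X,r)$ is not a simple solution.
   Context: A solution of the Yang–Baxter equation (YBE) is a pair $(X,r)$, where $X$ is a non-empty set and $r\colon X\times X\to X\times X$, written $r(x,y)=(\sigma_x(y),\gamma_y(x))$, satisfies: $r^2=\mathrm{id}$; all maps $\sigma_x,\gamma_y\colon X\to X$ are bijections; and $r_{12}r_{23}r_{12}=r_{23}r_{12}r_{23}$ as maps $X^3\to X^3$, where $r_{12}=r\times\mathrm{id}_X$ and $r_{23}=\mathrm{id}_X\times r$. (Then $\gamma_y(x)=\sigma^{-1}_{\sigma_x(y)}(x)$.) The permutation group of $(X,r)$ is $\mathcal G(X,r)=\langle \sigma_x : x\in X\rangle\le \mathrm{Sym}_X$. The solution is indecomposable if $\mathcal G(X,r)$ acts transitively on $X$. A homomorphism of solutions $f\colon(X,r)\to(Y,s)$ (with $s(t,z)=(\sigma'_t(z),\gamma'_z(t))$) is a map $f\colon X\to Y$ with $f(\sigma_x(y))=\sigma'_{f(x)}(f(y))$ for all $x,y\in X$; an epimorphism is a surjective homomorphism. A solution $(X,r)$ is simple if $|X|>1$ and every epimorphism of solutions $f\colon (X,r)\to (Y,s)$ is either an isomorphism or satisfies $|Y|=1$. The retract relation on $X$ is $x\sim y \iff \sigma_x=\sigma_y$; $r$ induces a solution $\bar r$ on $X/{\sim}$, and $\mathrm{Ret}(X,r)=(X/{\sim},\bar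 r)$. Set $\mathrm{Ret}^1=\mathrm{Ret}$ and $\mathrm{Ret}^{k}(X,r)=\mathrm{Ret}(\mathrm{Ret}^{k-1}(X,r))$. $(X,r)$ is a multipermutation solution if $|\mathrm{Ret}^k(X,r)|=1$ for some $k\ge1$; the least such $k$ is its multipermutation level. *)

(* Defs.v *)
From HB Require Import structures.
From mathcomp Require Import all_boot all_fingroup.
Set Implicit Arguments. Unset Strict Implicit. Unset Printing Implicit Defensive.

Definition sig_ {X : Type} (r : X * X -> X * X) (x y : X) : X := (r (x, y)).1.
Definition gam_ {X : Type} (r : X * X -> X * X) (y x : X) : X := (r (x, y)).2.

Definition r12 {X : Type} (r : X * X -> X * X) (t : X * X * X) : X * X * X :=
  let: (x, y, z) := t in let: (a, b) := r (x, y) in (a, b, z).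
Definition r23 {X : Type} (r : X * X -> X * X) (t : X * X * X) : X * X * X :=
  let: (x, y, z) := t in let: (b, c) := r (y, z) in (x, b, c).

Definition is_solution {X : Type} (r : X * X -> X * X) : Prop :=
  [/\ forall p, r (r p) = p,
      forall x, bijective (sig_ r x),
      forall y, bijective (gam_ r y)
    & forall t, r12 r (r23 r (r12 r t)) = r23 r (r12 r (r23 r t))].

Definition perm_gens {X : finType} (r : X * X -> X * X) : {set {perm X}} :=
  [set p : {perm X} | [exists x, [forall y, p y == sig_ r x y]]].
Definition perm_group_sol {X : finType} (r : X * X -> X * X) : {set {perm X}} :=
  (<<perm_gens r>>)%g.

Definition indecomposable {X : finType} (r : X * X -> X * X) : Prop :=
  [transitive perm_group_sol r, on [set: X] | 'P].

Definition sol_hom {X Y : Type} (r : X * X -> X * X) (s : Y * Y -> Y * Y)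
  (f : X -> Y) : Prop :=
  forall x y, f (sig_ r x y) = sig_ s (f x) (f y).

(* Simple solution.  Epimorphic images of a finite solution are finite, so
   quantifying over finite targets is no restriction. *)
Definition simple_sol {X : finType} (r : X * X -> X * X) : Prop :=
  1 < #|X| /\
  forall (Y : finType) (s : Y * Y -> Y * Y) (f : X -> Y),
    is_solution s -> sol_hom r s f -> (forall v : Y, exists u : X, f u = v) ->
    bijective f \/ #|Y| = 1.

Record fsol := FSol { car : finType; rmap : car * car -> car * car }.

(* Retraction: X/~ with x ~ y iff sigma_x = sigma_y.  The class of x is
   represented by the function sigma_x itself (as a finite function), so
   X/~ is realized as the set of all sigma_x. *)
Section Retract.
Variable S : fsol.
Local Notation X := (car S).
Local Notation r := (@rmap S).

Definition sigf (x : X) : {ffun X -> X} := [ffun y => sig_ r x y].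
Definition retP (f : {ffun X -> X}) : bool := [exists x, sigf x == f].
Definition retT : finType := {f : {ffun X -> X} | retP f}.

Lemma retP_sigf (x : X) : retP (sigf x).
Proof. by apply/existsP; exists x. Qed.

Definition cls (x : X) : retT := exist _ (sigf x) (retP_sigf x).
Definition rep (c : retT) : X := xchoose (existsP (valP c)).

Definition retmap (p : retT * retT) : retT * retT :=
  let: (a, b) := r (rep p.1, rep p.2) in (cls a, cls b).

Definition Ret : fsol := FSol retmap.
End Retract.

Definition multipermutation {X : finType} (r : X * X -> X * X) : Prop :=
  exists k, 0 < k /\ #|car (iter k Ret (FSol r))| = 1.

(* Main.v *)
Require Import Defs.
From mathcomp Require Import all_boot all_fingroup.
From mathcomp Require Import gfunctor cyclic commutator gseries pgroup nilpotent.
From mathcomp Require Import sylow abelian maximal integral_char.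

(* The permutation group G of a solution (X, r) is a finite left brace: it also
   carries an abelian group law A, on which G acts by automorphisms, and the
   elements sigma_x form a G-orbit generating A.  Retracting reduces the theorem
   to showing that an irretractable indecomposable solution of squarefree size
   is a singleton, i.e. that a finite brace in which G acts faithfully on A and
   A is generated by the orbit of some x of squarefree length is trivial.

   A finite brace has a solvable group, because the Hall subgroups of A are also
   subgroups of G (Wielandt's criterion and Burnside's theorem).  So some
   N = O_p(G) is nontrivial.  The cocycle identity shows that N fixes the
   p'-part H of A pointwise, while N moves x; since the orbit of x is
   squarefree, the length of the orbit of the p'-part y of x is prime to p.
   Hence H acts transitively on that orbit, and, up to conjugation, the Sylow
   p-subgroup P of A fixes y.  The fixed points of P in H form a subbrace W
   containing y.  By induction on the order, W = H modulo the socle of H, so W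
   and H have the same action on H, whence W contains the orbit of y and W = H.
   So P fixes H pointwise, is normal in G, and is abelian because its orbits on
   that of x have length at most p.  A nontrivial fixed point of P in its own
   additive group then acts trivially on A, which contradicts faithfulness.

   If n > 1, a simple solution would be isomorphic to its retraction, hence a
   singleton, or have all sigma_x equal to one cycle, and then it maps onto a
   cyclic permutation solution on p_1 points. *)

Set Implicit Arguments.
Unset Strict Implicit.
Unset Printing Implicit Defensive.
Local Open Scope group_scope.

(** * Wielandt's solvability criterion for three subgroups of pairwise coprime indices *)

Lemma index_quotient_dvdn (gT : finGroupType) (G H K : {group gT}) :
  K <| G -> H \subset G -> #|G / K : H / K| %| #|G : H|.
Proof.
move=> nKG sHG; have nHK := subset_trans sHG (normal_norm nKG).
have sKHG : K <*> H \subset G by rewrite join_subG normal_sub.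
rewrite -(quotientYidl nHK) index_quotient_eq ?normal_norm //.
  by rewrite indexgS // joing_subr.
by rewrite subIset // joing_subl orbT.
Qed.

(** As G = H1 H2 and [H1] normalizes [M], the G-conjugates of [M] are its H2-conjugates. [H2]
    contains a Sylow p-subgroup of [G], hence one of these conjugates, hence all of them. So [M]
    lies in the normal core of [H2], which serves as [K]. *)
Lemma solvable_of_coprime_index (gT : finGroupType) (G H1 H2 M : {group gT}) (p : nat) :
    H1 \subset G -> H2 \subset G -> coprime #|G : H1| #|G : H2| ->
    p^'.-nat #|G : H2| -> M <| H1 -> p.-group M -> solvable H2 -> M :!=: 1 ->
  exists K : {group gT}, [/\ K <| G, solvable K & K :!=: 1].
Proof.
move=> sH1 sH2 co p'H2 nMH1 pM solH2 ntM.
exists [group of gcore H2 G].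
have defG := coprime_index_mulG sH1 sH2 co.
have sMG := subset_trans (normal_sub nMH1) sH1.
have [Q sylQ] := Sylow_exists p H2.
have sylQG : p.-Sylow(G) Q.
  rewrite pHallE (subset_trans (pHall_sub sylQ)) //=.
  by rewrite (card_Hall sylQ) -(Lagrange sH2) partnM // (part_p'nat p'H2) muln1.
have conjM g : g \in G -> M :^ g \subset H2 -> M \subset H2.
  rewrite -defG => /mulsgP[h1 h2 h1H1 h2H2 ->].
  rewrite conjsgM (normsP (normal_norm nMH1) _ h1H1) => s.
  by rewrite -(conjSg _ _ h2) (conjGid h2H2).
have [g gG sMQg] := Sylow_subJ sylQG sMG pM.
have sMH2 : M \subset H2.
  apply: (conjM g^-1); first by rewrite groupV.
  by rewrite sub_conjgV (subset_trans sMQg) // conjSg (pHall_sub sylQ).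
split; first by rewrite /= /normal gcore_norm (subset_trans (gcore_sub _ _)).
  exact: solvableS (gcore_sub _ _) solH2.
apply: contraNneq ntM => /= K1; rewrite -subG1 -K1.
apply/bigcapsP => x xG; rewrite -sub_conjgV.
have : x^-1 \in H1 * H2 by rewrite defG groupV.
case/mulsgP=> h1 h2 h1H1 h2H2 ->.
by rewrite conjsgM (normsP (normal_norm nMH1) _ h1H1) -(conjGid h2H2) conjSg.
Qed.

Lemma solvable_pcore_neq1 (gT : finGroupType) (G : {group gT}) :
  solvable G -> G :!=: 1 -> exists2 p, prime p & 'O_p(G) != 1.
Proof.
move=> solG ntG; have [M minM sMG] := minnormal_exists ntG (normG G).
have [nMG ntM /is_abelemP[p p_pr abM]] := minnormal_solvable minM sMG solG.
exists p => //; apply: contraNneq ntM => Op1.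
by rewrite -subG1 -Op1 pcore_max ?(abelem_pgroup abM) // /normal sMG.
Qed.

(** A prime p with O_p(H1) nontrivial divides at most one of the indices of [H2] and [H3], so
    [solvable_of_coprime_index] yields a nontrivial solvable normal [K], and induction applies to
    G/K. *)
Lemma solvable_three_coprime_index (gT : finGroupType) (G H1 H2 H3 : {group gT}) :
    H1 \subset G -> H2 \subset G -> H3 \subset G ->
    coprime #|G : H1| #|G : H2| -> coprime #|G : H1| #|G : H3| ->
    coprime #|G : H2| #|G : H3| ->
    solvable H1 -> solvable H2 -> solvable H3 -> solvable G.
Proof.
have [n leGn] := ubnP #|G|; elim: n => // n IHn in gT G H1 H2 H3 leGn *.
move=> s1 s2 s3 c12 c13 c23 sol1 sol2 sol3.
have [H1_1 | ntH1] := eqVneq (H1 : {set gT}) 1.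
  (* The index of [H2] divides |G| = |G : H1|, to which it is coprime, so H2 = G. *)
  have : coprime #|G : H2| #|G : H2|.
    by apply: coprime_dvdl c12; rewrite H1_1 indexg1 dvdn_indexg.
  by rewrite /coprime gcdnn indexg_eq1 => sG2; apply: solvableS sol2.
have [p p_pr ntM] := solvable_pcore_neq1 sol1 ntH1.
have nM := pcore_normal p H1; have pM := pcore_pgroup p H1.
have [K [nKG solK ntK]] :
    exists K : {group gT}, [/\ K <| G, solvable K & K :!=: 1].
  have [p2 | p'2] := boolP (p %| #|G : H2|).
    apply: solvable_of_coprime_index nM pM sol3 ntM => //.
    by rewrite p'natE // -prime_coprime //; apply: coprime_dvdl p2 c23.
  by apply: solvable_of_coprime_index nM pM sol2 ntM; rewrite ?p'natE.
rewrite (series_sol nKG) solK.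
have co (A B : {group gT}) : A \subset G -> B \subset G ->
    coprime #|G : A| #|G : B| -> coprime #|G / K : A / K| #|G / K : B / K|.
  move=> sA sB /(coprime_dvdl (index_quotient_dvdn nKG sA)).
  exact: coprime_dvdr (index_quotient_dvdn nKG sB).
apply: (IHn _ _ (H1 / K)%G (H2 / K)%G (H3 / K)%G);
  rewrite ?quotientS ?quotient_sol ?co //.
exact: leq_trans (ltn_quotient ntK (normal_sub nKG)) leGn.
Qed.

(* A brace is encoded by its multiplicative group [G] acting on its additive
   group [A] (written multiplicatively) on the right by [to], together with the
   identity map [phi : G -> A], seen as a bijective 1-cocycle. *)
Record brace (gT aT : finGroupType) (G : {group gT}) (A : {group aT})
    (phi : gT -> aT) (to : aT -> gT -> aT) : Prop := Brace {
  brace_abelian : abelian A;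
  brace_im : phi @: G = A;
  brace_inj : {in G &, injective phi};
  brace_act_mem : forall a g, a \in A -> g \in G -> to a g \in A;
  brace_actM : forall g, g \in G -> {in A &, {morph to^~ g : a b / a * b}};
  brace_act1 : forall a, a \in A -> to a 1 = a;
  brace_act_mul : forall a g h, a \in A -> g \in G -> h \in G ->
    to a (g * h) = to (to a g) h;
  brace_cocycle : forall g h, g \in G -> h \in G ->
    phi (g * h) = to (phi g) h * phi h
}.

(** * Subbraces, stabilizers and orbits of a finite brace *)

Section BraceDefs.
Variables (gT aT : finGroupType) (G : {group gT}).
Variables (phi : gT -> aT) (to : aT -> gT -> aT).

(** Generated groups supply the group structure before closure is known; [brace_mem_pre] and
    [brace_mem_stab] show that nothing is added when [S] is a stable subgroup and [x] lies in
    [A]. *)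
Definition brace_pre (S : {set aT}) : {group gT} :=
  <<[set g in G | phi g \in S]>>%G.
Definition brace_stab (x : aT) : {group gT} := <<[set g in G | to x g == x]>>%G.
Definition brace_orbit (x : aT) : {set aT} := [set to x g | g in G].
(** Only the elements of [S] itself act: by the cocycle identity this closes the preimage of a
    subgroup [S] under products, which makes [S] a subbrace. *)
Definition brace_stable (S : {set aT}) :=
  forall a g, a \in S -> g \in G -> phi g \in S -> to a g \in S.

End BraceDefs.

Section BraceTheory.
Variables (gT aT : finGroupType) (G : {group gT}) (A : {group aT}).
Variables (phi : gT -> aT) (to : aT -> gT -> aT).
Hypothesis B : brace G A phi to.

Local Notation pre := (brace_pre G phi).
Local Notation stab := (brace_stab G to).
Local Notation orb := (brace_orbit G to).

Lemma brace_phi_mem g : g \in G -> phi g \in A.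
Proof. by move=> gG; rewrite -(brace_im B) imset_f. Qed.

Lemma brace_phiP a : a \in A -> exists2 g, g \in G & phi g = a.
Proof. by rewrite -(brace_im B) => /imsetP[g gG ->]; exists g. Qed.

Lemma brace_mulC a b : a \in A -> b \in A -> a * b = b * a.
Proof. by move=> aA bA; apply: (centsP (brace_abelian B)). Qed.

Lemma brace_phi1 : phi 1 = 1.
Proof.
have := brace_cocycle B (group1 G) (group1 G).
rewrite (brace_act1 B) ?brace_phi_mem ?group1 // mulg1 => e.
by apply: (mulgI (phi 1)); rewrite -e mulg1.
Qed.

Lemma brace_phi_eq1 g : g \in G -> (phi g == 1) = (g == 1).
Proof.
move=> gG; apply/eqP/eqP => [|->]; last exact: brace_phi1.
by rewrite -brace_phi1; apply: (brace_inj B).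
Qed.

Lemma brace_card : #|G| = #|A|.
Proof. by rewrite -(brace_im B) card_in_imset //; apply: brace_inj B. Qed.

Definition brace_act_morphism g (gG : g \in G) := Morphism (brace_actM B gG).

Lemma brace_act_one g : g \in G -> to 1 g = 1.
Proof. by move=> gG; apply: (morph1 (brace_act_morphism gG)). Qed.

Lemma brace_actK a g : a \in A -> g \in G -> to (to a g) g^-1 = a.
Proof.
by move=> aA gG; rewrite -(brace_act_mul B) ?groupV // mulgV (brace_act1 B).
Qed.

Lemma brace_actKV a g : a \in A -> g \in G -> to (to a g^-1) g = a.
Proof.
by move=> aA gG; rewrite -(brace_act_mul B) ?groupV // mulVg (brace_act1 B).
Qed.

Lemma brace_act_inj g : g \in G -> {in A &, injective (to^~ g)}.
Proof.
by move=> gG a b aA bA /= e; rewrite -(brace_actK aA gG) e brace_actK.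
Qed.

Lemma brace_act_constt pi a g : a \in A -> g \in G ->
  to a.`_pi g = (to a g).`_pi.
Proof. by move=> aA gG; apply: (morph_constt (brace_act_morphism gG)). Qed.

Lemma brace_mem_pcore pi a : a \in A -> (a \in 'O_pi(A)) = pi.-elt a.
Proof.
move=> aA; apply: mem_normal_Hall (pcore_normal _ _) aA.
exact/nilpotent_pcore_Hall/abelian_nil/(brace_abelian B).
Qed.

Lemma brace_pcore_sub pi a : a \in 'O_pi(A) -> a \in A.
Proof. exact: (subsetP (pcore_sub _ _)). Qed.

Lemma brace_constt_mem pi a : a \in A -> a.`_pi \in 'O_pi(A).
Proof. by move=> aA; rewrite brace_mem_pcore ?groupX ?p_elt_constt. Qed.

Lemma brace_act_pcore pi a g :
  a \in 'O_pi(A) -> g \in G -> to a g \in 'O_pi(A).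
Proof.
move=> aO gG; have aA := brace_pcore_sub aO.
rewrite brace_mem_pcore ?(brace_act_mem B) //.
have pia : pi.-elt a by rewrite -brace_mem_pcore.
by rewrite -(constt_p_elt pia) brace_act_constt ?p_elt_constt.
Qed.

Lemma brace_pcore_stable pi : brace_stable G phi to 'O_pi(A).
Proof. by move=> a g aO gG _; apply: brace_act_pcore. Qed.

Lemma brace_pcore_card pi : #|'O_pi(A)| = (#|A|`_pi)%N.
Proof.
exact/card_Hall/nilpotent_pcore_Hall/abelian_nil/(brace_abelian B).
Qed.

Section Sub.
Variable S : {group aT}.
Hypotheses (sSA : S \subset A) (stS : brace_stable G phi to S).

Lemma brace_mem_pre g : (g \in pre S) = (g \in G) && (phi g \in S).
Proof.
rewrite /brace_pre /= gen_set_id ?inE //; apply/group_setP; split.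
  by rewrite inE group1 brace_phi1 group1.
move=> x y; rewrite !inE => /andP[xG xS] /andP[yG yS].
by rewrite groupM //= (brace_cocycle B) // groupM ?stS.
Qed.

Lemma brace_pre_sub : pre S \subset G.
Proof. by apply/subsetP => g; rewrite brace_mem_pre => /andP[]. Qed.

Lemma brace_sub : brace (pre S) S phi to.
Proof.
have sG := subsetP brace_pre_sub; have sA := subsetP sSA.
split.
- exact: abelianS sSA (brace_abelian B).
- apply/setP => a; apply/imsetP/idP => [[g gS ->]|aS].
    by move: gS; rewrite brace_mem_pre => /andP[].
  have [g gG ga] := brace_phiP (sA _ aS).
  by exists g; rewrite // brace_mem_pre gG ga.
- by move=> g h /sG gG /sG hG; apply: (brace_inj B).
- by move=> a g aS; rewrite brace_mem_pre => /andP[]; apply: stS.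
- by move=> g /sG gG a b /sA aA /sA bA; apply: (brace_actM B).
- by move=> a /sA; apply: (brace_act1 B).
- by move=> a g h /sA aA /sG gG /sG hG; apply: (brace_act_mul B).
- by move=> g h /sG gG /sG hG; apply: (brace_cocycle B).
Qed.

End Sub.

Lemma brace_mem_pre_pcore pi g :
  (g \in pre 'O_pi(A)) = (g \in G) && (phi g \in 'O_pi(A)).
Proof. exact: brace_mem_pre (@brace_pcore_stable pi) g. Qed.

Lemma brace_pre_pcore_sub pi : pre 'O_pi(A) \subset G.
Proof. exact: brace_pre_sub (@brace_pcore_stable pi). Qed.

Lemma brace_sub_pcore pi : brace (pre 'O_pi(A)) 'O_pi(A) phi to.
Proof. exact: brace_sub (pcore_sub _ _) (@brace_pcore_stable pi). Qed.

Lemma brace_mem_stab x g : x \in A ->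
  (g \in stab x) = (g \in G) && (to x g == x).
Proof.
move=> xA; rewrite /brace_stab /= gen_set_id ?inE //; apply/group_setP; split.
  by rewrite inE group1 (brace_act1 B) /=.
move=> y z; rewrite !inE => /andP[yG /eqP y1] /andP[zG /eqP z1].
by rewrite groupM //= (brace_act_mul B) // y1 z1.
Qed.

Lemma brace_stab_sub x : x \in A -> stab x \subset G.
Proof. by move=> xA; apply/subsetP => g; rewrite brace_mem_stab // => /andP[]. Qed.

Lemma brace_stabJ x g : x \in A -> g \in G -> stab (to x g) = stab x :^ g :> {set gT}.
Proof.
move=> xA gG; apply/setP => h.
rewrite mem_conjg !brace_mem_stab ?(brace_act_mem B) // groupJr ?groupV //.
have [hG | //] := boolP (h \in G); rewrite /= conjgE invgK.
rewrite !(brace_act_mul B) ?groupM ?groupV ?(brace_act_mem B) //.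
apply/eqP/eqP => [->|e]; first exact: brace_actK.
by rewrite -{2}e brace_actKV ?(brace_act_mem B).
Qed.

Lemma brace_orbit_sub x : x \in A -> orb x \subset A.
Proof. by move=> xA; apply/subsetP => _ /imsetP[g gG ->]; apply: (brace_act_mem B). Qed.

Lemma brace_orbit_act x g : x \in A -> g \in G -> orb (to x g) = orb x.
Proof.
move=> xA gG; apply/setP => y; apply/imsetP/imsetP => [] [h hG ->].
  by exists (g * h); rewrite ?groupM // (brace_act_mul B).
exists (g^-1 * h); rewrite ?groupM ?groupV //.
by rewrite (brace_act_mul B) ?(brace_act_mem B) ?groupV // brace_actK.
Qed.

Lemma brace_fix_gen x g : x \in A -> <<orb x>> = A -> g \in G ->
  (forall h, h \in G -> to (to x h) g = to x h) -> forall a, a \in A -> to a g = a.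
Proof.
move=> xA gen gG fix_g a; rewrite -{1}gen.
set F := [set b in A | to b g == b].
have gF : group_set F.
  apply/group_setP; split; first by rewrite inE group1 brace_act_one /=.
  move=> b c; rewrite !inE => /andP[bA /eqP bF] /andP[cA /eqP cF].
  by rewrite groupM // (brace_actM B) // bF cF /=.
suff : <<orb x>> \subset Group gF.
  by move=> /subsetP s /s; rewrite inE => /andP[_ /eqP].
rewrite gen_subG; apply/subsetP => _ /imsetP[h hG ->].
by rewrite inE fix_g // eqxx (brace_act_mem B).
Qed.

(** Being normal, [N] lies in all conjugates of the stabilizer, so it fixes the whole orbit, which
    generates [A]. *)
Lemma brace_normal_sub_stab x (N : {group gT}) :
    x \in A -> <<orb x>> = A -> N <| G -> N \subset stab x ->
  forall g a, g \in N -> a \in A -> to a g = a.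
Proof.
move=> xA gen /andP[sNG nNG] sNx g a gN aA.
apply: (brace_fix_gen xA gen) => //; first exact: (subsetP sNG).
move=> h hG; have : g \in stab (to x h).
  have /subsetP-> // : N \subset stab (to x h).
  by rewrite brace_stabJ // -(normsP nNG h hG) conjSg.
by rewrite brace_mem_stab ?(brace_act_mem B) // => /andP[_ /eqP].
Qed.

Lemma brace_pre_card (S : {group aT}) :
  S \subset A -> brace_stable G phi to S -> #|pre S| = #|S|.
Proof.
move=> sSA stS; rewrite -[in RHS](brace_im (brace_sub sSA stS)) card_in_imset //.
exact: brace_inj (brace_sub sSA stS).
Qed.

(** As [phi] is bijective, the preimage has as order the pi-part of |A| = |G|. This is how [G] gets
    Hall subgroups for every pi. *)
Lemma brace_pre_Hall pi : pi.-Hall(G) (pre 'O_pi(A)).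
Proof.
rewrite pHallE brace_pre_pcore_sub brace_pre_card ?pcore_sub //.
  by rewrite brace_pcore_card brace_card /=.
exact: brace_pcore_stable.
Qed.

Lemma brace_constt_mul pi a b : a \in 'O_pi(A) -> b \in 'O_pi^'(A) ->
  (a * b).`_pi = a /\ (a * b).`_pi^' = b.
Proof.
move=> aO bO; have [aA bA] := (brace_pcore_sub aO, brace_pcore_sub bO).
have cab : commute a b by apply: brace_mulC.
rewrite brace_mem_pcore // in aO; rewrite brace_mem_pcore // in bO.
rewrite !consttM // (constt_p_elt aO) (constt_p_elt bO) (constt1P bO).
by rewrite (constt1P _) ?p_eltNK // mulg1 mul1g.
Qed.

(** With [phi h = a] and k = h g h^-1, expanding h g = k h by the cocycle identity gives
    [to a g * phi g = to (phi k) h * a]. Both [phi g] and [phi k] are pi-elements, because O_pi(G)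
    lies in every Hall pi-subgroup; comparing pi'-parts gives the claim. *)
Lemma brace_pcore_act_triv pi a g :
  g \in 'O_pi(G) -> a \in 'O_pi^'(A) -> to a g = a.
Proof.
move=> gO aO; have aA := brace_pcore_sub aO.
have gG : g \in G by apply: (subsetP (pcore_sub _ _)) gO.
have phiO h : h \in 'O_pi(G) -> phi h \in 'O_pi(A).
  move=> hO; have /subsetP/(_ h hO) := pcore_sub_Hall (brace_pre_Hall pi).
  by rewrite brace_mem_pre_pcore => /andP[].
have [h hG ha] := brace_phiP aA.
set k := g ^ h^-1.
have kO : k \in 'O_pi(G) by rewrite memJ_norm ?groupV // (subsetP (gFnorm _ _)).
have kG : k \in G by apply: (subsetP (pcore_sub _ _)) kO.
have e : h * g = k * h by rewrite /k conjgE invgK !mulgA mulgKV.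
have := congr1 phi e; rewrite (brace_cocycle B hG gG) (brace_cocycle B kG hG) ha.
have phg := phiO _ gO; have phk : to (phi k) h \in 'O_pi(A).
  by rewrite brace_act_pcore ?phiO.
rewrite brace_mulC ?(brace_act_mem B) ?brace_phi_mem //=.
move=> /(congr1 (fun x => x.`_pi^')).
have [_ ->] := brace_constt_mul phg (brace_act_pcore aO gG).
by have [_ ->] := brace_constt_mul phk aO.
Qed.

End BraceTheory.

(** * Solvability of the multiplicative group *)

Lemma pcore'_ltn (gT : finGroupType) (G : {group gT}) (p : nat) :
  p \in \pi(G) -> #|'O_p^'(G)| < #|G|.
Proof.
move=> piGp; rewrite ltn_neqAle (subset_leq_card (pcore_sub _ _)) andbT.
apply/eqP => e; move: piGp; rewrite mem_primes => /and3P[p_pr _ pG].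
by have := pcore_pgroup p^' G; rewrite /pgroup e p'natE // pG.
Qed.

(** The preimage of O_l'(A) is a smaller brace whose index in [G] is a power of l. Three primes give
    three such subgroups, solvable by induction; with at most two primes Burnside's theorem
    applies. *)
Lemma brace_solvable (gT aT : finGroupType) (G : {group gT}) (A : {group aT})
  (phi : gT -> aT) (to : aT -> gT -> aT) : brace G A phi to -> solvable G.
Proof.
have [n leAn] := ubnP #|A|; elim: n => // n IHn in G A leAn * => B.
have [/Burnside_p_a_q_b //|] := leqP (size (primes #|G|)) 2.
pose H (l : nat) := brace_pre G phi 'O_l^'(A).
have solH l : l \in primes #|G| -> solvable (H l).
  move=> lG; apply: IHn (brace_sub_pcore B _).
  rewrite (brace_card B) in lG; exact: leq_trans (pcore'_ltn lG) leAn.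
have sH l : H l \subset G by apply: (brace_pre_pcore_sub B).
have piH (l : nat) : l.-nat #|G : H l|.
  by have /and3P[_ _] := brace_pre_Hall B l^'; rewrite pnatNK.
have co l m : l != m -> coprime #|G : H l| #|G : H m|.
  move=> ne; apply: pnat_coprime (piH l) _.
  by apply: sub_in_pnat (piH m) => x _; rewrite !inE => /eqP->; rewrite eq_sym.
have := primes_uniq #|G|.
case: (primes #|G|) solH => [|p [|q [|r s]]] //= solH.
rewrite !inE !negb_or => /and3P[/and3P[pq pr _] /andP[qr _] _] _.
by apply: (@solvable_three_coprime_index _ G (H p) (H q) (H r));
  rewrite ?co ?solH ?inE ?eqxx ?orbT.
Qed.

(** * The socle and the quotient brace *)

Section Socle.
Variables (gT aT : finGroupType) (G : {group gT}) (A : {group aT}).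
Variables (phi : gT -> aT) (to : aT -> gT -> aT).
Hypothesis B : brace G A phi to.

Definition brace_ker : {group gT} :=
  <<[set g in G | [forall a in A, to a g == a]]>>%G.

Local Notation K := brace_ker.

Lemma brace_kerP g :
  reflect (g \in G /\ forall a, a \in A -> to a g = a) (g \in K).
Proof.
rewrite /brace_ker /= gen_set_id; last first.
  apply/group_setP; split.
    rewrite inE group1; apply/forall_inP => a aA.
    by rewrite (brace_act1 B).
  move=> x y; rewrite !inE => /andP[xG /forall_inP fx] /andP[yG /forall_inP fy].
  rewrite groupM //; apply/forall_inP => a aA.
  by rewrite (brace_act_mul B) // (eqP (fx _ aA)) (eqP (fy _ aA)).
rewrite inE; apply: (iffP andP) => -[gG fg]; split => //.
  by move=> a aA; apply/eqP/(forall_inP fg).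
by apply/forall_inP => a aA; rewrite fg.
Qed.

Lemma brace_ker_normal : K <| G.
Proof.
apply/andP; split; first by apply/subsetP => g /brace_kerP[].
apply/normsP => h hG; apply/eqP; rewrite eqEcard cardJg leqnn andbT.
apply/subsetP => _ /imsetP[g /brace_kerP[gG fg] ->].
apply/brace_kerP; split; first exact: groupJ.
move=> a aA; rewrite conjgE.
rewrite !(brace_act_mul B) ?groupM ?groupV ?(brace_act_mem B) ?groupV //.
by rewrite fg ?(brace_actKV B) ?(brace_act_mem B) ?groupV.
Qed.

Lemma brace_phi_kerM s g : s \in G -> g \in K -> phi (s * g) = phi s * phi g.
Proof.
move=> sG /brace_kerP[gG fg].
by rewrite (brace_cocycle B) // fg ?(brace_phi_mem B).
Qed.

(** On the kernel [phi] is multiplicative by [brace_phi_kerM], so its image is already a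
    subgroup. *)
Definition brace_socle : {group aT} := <<[set phi g | g in K]>>%G.
Local Notation I := brace_socle.

Lemma brace_socleP a : reflect (exists2 g, g \in K & phi g = a) (a \in I).
Proof.
have -> : I = phi @: K :> {set aT}.
  apply/gen_set_id/group_setP; split.
    by apply/imsetP; exists 1; rewrite ?group1 ?(brace_phi1 B).
  move=> _ _ /imsetP[x xK ->] /imsetP[y yK ->].
  apply/imsetP; exists (x * y); rewrite ?groupM // brace_phi_kerM //.
  by case/brace_kerP: xK.
by apply: (iffP imsetP) => -[g gK e]; exists g.
Qed.

Lemma brace_socle_sub : I \subset A.
Proof.
apply/subsetP => _ /brace_socleP[g /brace_kerP[gG _] <-].
exact: (brace_phi_mem B).
Qed.

Lemma brace_socle_normal : I <| A.
Proof. by rewrite -(sub_abelian_normal _ (brace_abelian B)) brace_socle_sub. Qed.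

(** Compare the cocycle expansions of the two sides of s g = g s^g, where s^g is in the kernel and
    acts trivially. *)
Lemma brace_act_phi_ker s g : s \in K -> g \in G -> to (phi s) g = phi (s ^ g).
Proof.
move=> sK gG; have [sG _] := brace_kerP _ sK.
have sgK : s ^ g \in K by rewrite memJ_norm // (subsetP (normal_norm brace_ker_normal)).
apply: (mulIg (phi g)); rewrite -(brace_cocycle B) //.
rewrite (brace_mulC B) ?(brace_phi_mem B) ?groupJ // -brace_phi_kerM //.
by rewrite conjgC.
Qed.

Lemma brace_act_socle a g : a \in I -> g \in G -> to a g \in I.
Proof.
move=> /brace_socleP[s sK <-] gG; rewrite brace_act_phi_ker //.
apply/brace_socleP; exists (s ^ g) => //.
by rewrite memJ_norm // (subsetP (normal_norm brace_ker_normal)).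
Qed.

(** Both maps go through coset representatives; [quo_phiE] and [quo_actE] show independence of the
    choice. *)
Definition quo_phi (c : coset_of K) : coset_of I := coset I (phi (repr c)).
Definition quo_act (d : coset_of I) (c : coset_of K) : coset_of I :=
  coset I (to (repr d) (repr c)).

Lemma repr_coset_mul (T : finGroupType) (N : {group T}) x :
  x \in 'N(N) -> exists2 k, k \in N & repr (coset N x) = k * x.
Proof.
move=> xN; have := mem_repr_coset (coset N x).
by rewrite val_coset // => /rcosetP[k kN ->]; exists k.
Qed.

Let nK g : g \in G -> g \in 'N(K).
Proof. exact: (subsetP (normal_norm brace_ker_normal)). Qed.
Let nI a : a \in A -> a \in 'N(I).
Proof. exact: (subsetP (normal_norm brace_socle_normal)). Qed.
Let sI := subsetP brace_socle_sub.

Lemma quo_phiE g : g \in G -> quo_phi (coset K g) = coset I (phi g).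
Proof.
move=> gG; rewrite /quo_phi; have [k kK ->] := repr_coset_mul (nK gG).
have [kG _] := brace_kerP _ kK.
have kI : to (phi k) g \in I.
  by apply: brace_act_socle => //; apply/brace_socleP; exists k.
by rewrite (brace_cocycle B) // coset_kerl.
Qed.

Lemma quo_actE a g : a \in A -> g \in G ->
  quo_act (coset I a) (coset K g) = coset I (to a g).
Proof.
move=> aA gG; rewrite /quo_act.
have [k kK ->] := repr_coset_mul (nK gG).
have [i iI ->] := repr_coset_mul (nI aA).
have [kG fk] := brace_kerP _ kK; have iA := sI iI.
rewrite (brace_act_mul B) ?groupM // fk ?groupM // (brace_actM B) //.
by rewrite coset_kerl // brace_act_socle.
Qed.

Lemma brace_quotient : brace (G / K) (A / I) quo_phi quo_act.
Proof.
have PG c : c \in G / K -> exists2 g, g \in G & c = coset K g.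
  by case/morphimP => g _ gG ->; exists g.
have PA d : d \in A / I -> exists2 a, a \in A & d = coset I a.
  by case/morphimP => a _ aA ->; exists a.
have GP g : g \in G -> coset K g \in G / K by apply: mem_quotient.
have AP a : a \in A -> coset I a \in A / I by apply: mem_quotient.
have phiA := brace_phi_mem B; have actA := brace_act_mem B.
split.
- exact: quotient_abelian (brace_abelian B).
- apply/setP => d; apply/imsetP/idP => [[_ /PG[g gG ->] ->]|/PA[a aA ->]].
    by rewrite quo_phiE ?AP ?phiA.
  have [g gG <-] := brace_phiP B aA.
  by exists (coset K g); rewrite ?GP ?quo_phiE.
- move=> _ _ /PG[g gG ->] /PG[h hG ->]; rewrite !quo_phiE // => e.
  have [i iI ei] : exists2 i, i \in I & phi g = i * phi h.
    by apply/rcosetP/rcoset_kercosetP; rewrite ?nI ?phiA.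
  (* Since [phi (s * h) = to (phi s) h * phi h], a factor [s] with g = s h must satisfy
     [phi s = to i h^-1]. *)
  have hVI : to i h^-1 \in I by rewrite brace_act_socle ?groupV.
  have [s sK es] := brace_socleP _ hVI; have [sG _] := brace_kerP _ sK.
  have -> : g = s * h.
    apply: (brace_inj B); rewrite ?groupM // (brace_cocycle B) // es.
    by rewrite (brace_actKV B) ?sI.
  by rewrite coset_kerl.
- by move=> _ _ /PA[a aA ->] /PG[g gG ->]; rewrite quo_actE ?AP ?actA.
- move=> _ /PG[g gG ->] _ _ /PA[a aA ->] /PA[b bA ->].
  by rewrite -morphM ?nI // !quo_actE ?groupM // -morphM ?nI ?actA // (brace_actM B).
- move=> _ /PA[a aA ->]; rewrite -(coset_id (group1 K)) quo_actE //.
  by rewrite (brace_act1 B).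
- move=> _ _ _ /PA[a aA ->] /PG[g gG ->] /PG[h hG ->].
  by rewrite -morphM ?nK // !quo_actE ?groupM ?actA // (brace_act_mul B).
- move=> _ _ /PG[g gG ->] /PG[h hG ->].
  rewrite -morphM ?nK // !quo_phiE ?groupM // quo_actE ?phiA //.
  by rewrite -morphM ?nI ?actA ?phiA // (brace_cocycle B).
Qed.

End Socle.

(** * Squarefree orbit lengths and the statement carried through the induction *)

Definition squarefree (n : nat) := forall p : nat, prime p -> ~~ (p ^ 2 %| n)%N.

Lemma squarefree_dvdn m n : m %| n -> squarefree n -> squarefree m.
Proof. by move=> mn sf p /sf; apply: contra => /dvdn_trans->. Qed.

(** A proper subbrace cannot contain a point whose orbit generates [A] and has squarefree length.
    Unlike the triviality of faithful braces, this property can be passed through the quotient by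
    the socle. *)
Definition one_generated (gT aT : finGroupType) (G : {group gT})
    (A : {group aT}) (phi : gT -> aT) (to : aT -> gT -> aT) :=
  forall (x : aT) (S : {group aT}),
    x \in A -> <<brace_orbit G to x>> = A ->
    squarefree #|G : brace_stab G to x| ->
    S \subset A -> brace_stable G phi to S -> x \in S -> S :=: A.

(** Here [#|P : D|] is the index of the intersection of [P] and [D] in [P], which equals |DP :
    D|. *)
Lemma index_normal_dvdn (gT : finGroupType) (G D P : {group gT}) :
  P <| G -> D \subset G -> #|P : D| %| #|G : D|.
Proof.
move=> /andP[sPG nPG] sDG; have nPD := subset_trans sDG nPG.
have sK : D <*> P \subset G by rewrite join_subG sDG.
have /eqP := mul_cardG D P; rewrite -(norm_joinEl nPD).
rewrite -(Lagrange (joing_subl D P)) -(LagrangeI P D) setIC mulnA [X in _ == X]mulnAC.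
rewrite eqn_pmul2l ?muln_gt0 ?cardG_gt0 // => /eqP->.
by rewrite -(Lagrange_index sK (joing_subl D P)) dvdn_mull.
Qed.

(** * Faithful braces generated by an orbit of squarefree length *)

Section Core.
Variables (gT aT : finGroupType) (G : {group gT}) (A : {group aT}).
Variables (phi : gT -> aT) (to : aT -> gT -> aT).
Hypothesis B : brace G A phi to.
Hypothesis kerB : brace_ker G A to :=: 1.
Hypothesis IH : forall (H : {group gT}) (S : {group aT}),
  #|S| < #|A| -> brace H S phi to -> one_generated H S phi to.

Local Notation stab := (brace_stab G to).
Local Notation orb := (brace_orbit G to).

Lemma brace_stab_constt pi x :
  x \in A -> stab x \subset stab x.`_pi.
Proof.
move=> xA; apply/subsetP => g; rewrite !(brace_mem_stab B) ?groupX //.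
by case/andP=> gG /eqP e; rewrite gG (brace_act_constt B) ?e /=.
Qed.

(** Choose [b] with [phi b = to (phi a) g]. As [b] fixes [phi g], both a g and g b have the image
    [phi g * phi b], so a^g = b. *)
Lemma brace_fix_normalizes pi g : g \in G ->
  (forall b, b \in brace_pre G phi 'O_pi(A) -> to (phi g) b = phi g) ->
  g \in 'N(brace_pre G phi 'O_pi(A)).
Proof.
move=> gG fix_g; rewrite inE; apply/subsetP => _ /imsetP[a aP ->].
move: aP; rewrite !(brace_mem_pre_pcore B) => /andP[aG aO].
have agO := brace_act_pcore B aO gG.
have [b bG eb] := brace_phiP B (brace_pcore_sub agO).
suff -> : a ^ g = b by rewrite bG eb.
have e : a * g = g * b.
  apply: (brace_inj B); rewrite ?groupM // !(brace_cocycle B) //.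
  rewrite fix_g ?(brace_mem_pre_pcore B) ?bG ?eb //.
  by apply: (brace_mulC B); rewrite ?(brace_phi_mem B) // -eb (brace_phi_mem B).
by rewrite conjgE e mulKg.
Qed.

Section Point.
Variable x : aT.
Hypotheses (xA : x \in A) (gen : <<orb x>> = A).
Hypothesis sf : squarefree #|G : stab x|.

Lemma normal_sub_stab_trivial (N : {group gT}) :
  N <| G -> N \subset stab x -> N :=: 1.
Proof.
move=> nNG sNx; apply/trivgP; rewrite -kerB; apply/subsetP => g gN.
apply/(brace_kerP B); split; first exact: (subsetP (normal_sub nNG)).
by move=> a aA; apply: (brace_normal_sub_stab B xA gen nNG sNx).
Qed.

(** Otherwise p, dividing |G : stab y|, would not divide |stab y : stab x|, and a Sylow p-subgroup
    of [stab x] would be one of [stab y]. It would contain O_p(G), which fixes the p'-part y; then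
    O_p(G) would fix [x] and be trivial by faithfulness. *)
Lemma pcore_index_stab (p : nat) :
  prime p -> 'O_p(G) != 1 -> p^'.-nat #|G : stab x.`_p^'|.
Proof.
move=> p_pr; set y := x.`_p^'; apply: contraR; rewrite p'natE // negbK => pE.
have yO : y \in 'O_p^'(A) by apply: (brace_constt_mem B).
have yA := brace_pcore_sub yO.
have sDE : stab x \subset stab y by apply: brace_stab_constt.
have sEG : stab y \subset G by apply: (brace_stab_sub B).
have sNE : 'O_p(G) \subset stab y.
  apply/subsetP => g gO; rewrite (brace_mem_stab B) //.
  by rewrite (subsetP (pcore_sub _ _) _ gO) (brace_pcore_act_triv B gO) //=.
have p'ED : p^'.-nat #|stab y : stab x|.
  rewrite p'natE //; apply: contra (sf p_pr) => pED.
  by rewrite -(Lagrange_index sEG sDE) expnS expn1 dvdn_mul.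
have [Q sylQ] := Sylow_exists p (stab x).
have sQD := pHall_sub sylQ.
have sylQE : p.-Sylow(stab y) Q.
  rewrite pHallE (subset_trans sQD) //=.
  by rewrite (card_Hall sylQ) -(Lagrange sDE) partnM // (part_p'nat p'ED) muln1.
apply/eqP/normal_sub_stab_trivial; first exact: pcore_normal.
apply: subset_trans sQD; apply: subset_trans (pcore_sub_Hall sylQE).
by rewrite pcore_max ?pcore_pgroup // (normalS sNE sEG) ?pcore_normal.
Qed.

Local Notation P p := (brace_pre G phi 'O_p(A)).
Local Notation H p := (brace_pre G phi 'O_p^'(A)).

Lemma pcore_sub_stab_conj (p : nat) : prime p -> 'O_p(G) != 1 ->
  exists2 g, g \in G & P p \subset stab (to x g).`_p^'.
Proof.
move=> p_pr ntO; have p'E := pcore_index_stab p_pr ntO.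
set y := x.`_p^' in p'E.
have yA : y \in A by rewrite groupX.
have sEG : stab y \subset G by apply: (brace_stab_sub B).
have [Q sylQ] := Sylow_exists p (stab y).
have sylQG : p.-Sylow(G) Q.
  rewrite pHallE (subset_trans (pHall_sub sylQ)) //=.
  by rewrite (card_Hall sylQ) -(Lagrange sEG) partnM // (part_p'nat p'E) muln1.
have [g gG defP] := Sylow_trans sylQG (brace_pre_Hall B p).
exists g; rewrite // defP -(brace_act_constt B) // (brace_stabJ B) // conjSg.
exact: pHall_sub sylQ.
Qed.

(** [IH] is applied to the p'-part of [A] with the point [z] and the subbrace [F] of fixed points of
    [P p]. *)
Lemma pre_pcore_act_triv (p : nat) : prime p -> 'O_p(G) != 1 ->
    P p \subset stab x.`_p^' ->
  forall a g, a \in 'O_p^'(A) -> g \in P p -> to a g = a.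
Proof.
move=> p_pr ntO sPz; set z := x.`_p^' in sPz.
have BH := brace_sub_pcore B p^'.
have sPG : P p \subset G by apply: (brace_pre_pcore_sub B).
have sHG : H p \subset G by apply: (brace_pre_pcore_sub B).
have zO : z \in 'O_p^'(A) by apply: (brace_constt_mem B).
have zA := brace_pcore_sub zO.
have sEG : stab z \subset G by apply: (brace_stab_sub B).
have p'E := pcore_index_stab p_pr ntO.
have pH : p.-nat #|G : H p|.
  by have /and3P[_ _] := brace_pre_Hall B p^'; rewrite pnatNK.
(* The two indices are coprime, so [H p] is transitive on the orbit of [z]. *)
have defG : stab z * H p = G.
  by apply: coprime_index_mulG => //; rewrite coprime_sym; apply: pnat_coprime pH p'E.
have orbE : brace_orbit (H p) to z = orb z.
  apply/setP => a; apply/imsetP/imsetP => [] [g gG ->].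
    by exists g => //; apply: (subsetP sHG).
  move: gG; rewrite -defG => /mulsgP[e h eE hH ->].
  move: eE; rewrite (brace_mem_stab B) // => /andP[eG /eqP ez].
  by exists h; rewrite // (brace_act_mul B) ?ez // (subsetP sHG).
(* Taking p'-parts is a morphism on [A] that maps the generating orbit of [x] onto the orbit of
   [z]. *)
have genz : <<brace_orbit (H p) to z>> = 'O_p^'(A).
  apply/eqP; rewrite eqEsubset gen_subG (brace_orbit_sub BH) //=.
  rewrite orbE; set T := <<_>>.
  pose F := [set a in A | a.`_p^' \in T].
  have gF : group_set F.
    apply/group_setP; split; first by rewrite inE group1 constt1 group1.
    move=> a b; rewrite !inE => /andP[aA aT'] /andP[bA bT'].
    by rewrite groupM //= consttM ?groupM //; apply: (brace_mulC B).
  have sAF : A \subset F.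
    rewrite -gen -[F]/(gval (Group gF)) gen_subG.
    apply/subsetP => _ /imsetP[g gG ->]; rewrite inE (brace_act_mem B) //=.
    by rewrite -(brace_act_constt B) // mem_gen // imset_f.
  apply/subsetP => a aO; have aA := brace_pcore_sub aO.
  have := subsetP sAF a aA; rewrite inE => /andP[_].
  by rewrite (brace_mem_pcore B) // in aO; rewrite (constt_p_elt aO).
(* By transitivity this index is |G : stab z|, a divisor of |G : stab x|. *)
have sfz : squarefree #|H p : brace_stab (H p) to z|.
  apply: squarefree_dvdn sf.
  have -> : brace_stab (H p) to z = H p :&: stab z :> {set gT}.
    apply/setP => g; rewrite inE (brace_mem_stab BH) // (brace_mem_stab B) //.
    by case gH: (g \in H p); rewrite //= (subsetP sHG _ gH).
  apply: dvdn_trans (indexgS G (brace_stab_constt p^' xA)).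
  have e := mul_cardG (stab z) (H p).
  rewrite defG -(Lagrange sEG) -(LagrangeI (H p) (stab z)) setIC in e.
  have /eqP := e; rewrite mulnA [X in _ == X]mulnAC eqn_pmul2l ?muln_gt0 ?cardG_gt0 //.
  by rewrite indexgI => /eqP ->.
set F := [set a in 'O_p^'(A) | [forall g in P p, to a g == a]].
have gF : group_set F.
  apply/group_setP; split.
    rewrite inE group1; apply/forall_inP => g gP.
    by rewrite (brace_act_one B) // (subsetP sPG).
  move=> a b; rewrite !inE => /andP[aO /forall_inP aF] /andP[bO /forall_inP bF].
  rewrite groupM //; apply/forall_inP => g gP; have gG := subsetP sPG g gP.
  rewrite (brace_actM B) ?(brace_pcore_sub aO) ?(brace_pcore_sub bO) //.
  by rewrite (eqP (aF _ gP)) (eqP (bF _ gP)).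
(* Since [phi g] is fixed by [P p], [g] normalizes [P p]; then g h = h' g with h' in [P p], and h'
   fixes [a]. *)
have stF : brace_stable (H p) phi to F.
  move=> a g; rewrite !inE => /andP[aO /forall_inP aF] gH /andP[_ /forall_inP gFx].
  have gG := subsetP sHG g gH; rewrite (brace_act_pcore B) //=.
  have /normP nPg : g \in 'N(P p).
    by apply: brace_fix_normalizes => // b bP; apply/eqP/gFx.
  apply/forall_inP => h hP; have hG := subsetP sPG h hP.
  have aA := brace_pcore_sub aO.
  rewrite -(brace_act_mul B) // conjgCV.
  have h'P : h ^ g^-1 \in P p by rewrite -mem_conjg nPg.
  rewrite (brace_act_mul B) ?(subsetP sPG _ h'P) //.
  by rewrite (eqP (aF _ h'P)).
have defF : F = 'O_p^'(A).
  have ltO : #|'O_p^'(A)| < #|A|.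
    apply: pcore'_ltn; rewrite /= -(brace_card B) mem_primes p_pr cardG_gt0 /=.
    have [_ pO _] := pgroup_pdiv (pcore_pgroup p G) ntO.
    exact: dvdn_trans pO (cardSg (pcore_sub _ _)).
  apply: (@IH _ _ ltO BH z (Group gF) zO genz sfz) => //.
    by apply/subsetP => a; rewrite inE => /andP[].
  rewrite inE zO; apply/forall_inP => g /(subsetP sPz).
  by rewrite (brace_mem_stab B) // => /andP[].
move=> a g; rewrite -defF inE => /andP[_ /forall_inP aF] gP.
exact/eqP/aF.
Qed.

Section Final.
Variable p : nat.
Hypotheses (p_pr : prime p) (ntO : 'O_p(G) != 1).
Hypothesis trivP : forall a g, a \in 'O_p^'(A) -> g \in P p -> to a g = a.

(** G = P H, and [h] in [H p] has [phi h] in the p'-part of [A], fixed by [P p]; so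
    [brace_fix_normalizes] applies. *)
Lemma pre_pcore_normal : P p <| G.
Proof.
have pP := brace_pre_Hall B p; have pH := brace_pre_Hall B p^'.
rewrite /normal (pHall_sub pP) andTb.
have defG : P p * H p = G.
  apply: coprime_index_mulG (pHall_sub pP) (pHall_sub pH) _.
  have /and3P[_ _ iP] := pP; have /and3P[_ _ iH] := pH.
  by rewrite coprime_sym; apply: pnat_coprime iP; rewrite pnatNK in iH.
rewrite -defG mul_subG ?normG //; apply/subsetP => h.
rewrite (brace_mem_pre_pcore B) => /andP[hG hO].
by apply: brace_fix_normalizes => // b; apply: trivP.
Qed.

Lemma pre_pcore_pgroup : p.-group (P p).
Proof. by have /and3P[] := brace_pre_Hall B p. Qed.

(** The index of P ∩ stab x in P is a power of p dividing a squarefree number, so it is 1 or p. In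
    both cases the derived subgroup of P fixes [x]; being normal in [G], it is trivial. *)
Lemma pre_pcore_abelian : abelian (P p).
Proof.
have nPG := pre_pcore_normal; have pP := pre_pcore_pgroup.
have sDG := brace_stab_sub B xA.
apply/derG1P/normal_sub_stab_trivial; first exact: char_normal_trans (der_char 1 _) nPG.
have iPD := index_normal_dvdn nPG sDG.
have /p_natP[k ek] : p.-nat #|P p : P p :&: stab x|.
  exact: pnat_dvd (dvdn_indexg _ _) pP.
have {iPD} : (p ^ k %| #|G : stab x|)%N by rewrite -ek indexgI.
move=> iPD; apply: (subset_trans _ (subsetIr (P p) (stab x))).
case: k ek iPD => [|[|k]] ek iPD.
- move/eqP: ek; rewrite indexg_eq1; apply: subset_trans.
  exact: der_sub.
- have maxD : maximal (P p :&: stab x) (P p).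
    by apply: p_index_maximal; rewrite ?subsetIl // ek.
  have nD := p_maximal_normal pP maxD.
  apply: der1_min (normal_norm nD) _; apply: cyclic_abelian.
  by apply: prime_cyclic; rewrite card_quotient ?normal_norm // ek.
- case/negP: (sf p_pr); apply: dvdn_trans iPD; exact: dvdn_exp2l.
Qed.

(** A p-group acting on a nontrivial p-group has a number of fixed points divisible by p, and 1 is
    among them. *)
Lemma pre_pcore_fix : exists b, [/\ b \in 'O_p(A), b != 1 &
  forall g, g \in P p -> to b g = b].
Proof.
(* An action must be injective on the whole type, so [to] is replaced by the identity outside [A]
   and [G]. *)
pose to' a g := if (a \in A) && (g \in G) then to a g else a.
have act_to' : is_action G to'.
  split=> [g a b|a g h gG hG]; rewrite /to' /=; last first.
    rewrite groupM // gG hG !andbT; case: (boolP (a \in A)) => [aA|/negPf-> //].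
    by rewrite (brace_act_mem B) // (brace_act_mul B).
  case: (boolP (g \in G)) => [gG|_]; rewrite ?andbF // !andbT.
  case: ifP => aA; case: ifP => bA // e.
  - exact: (brace_act_inj B gG).
  - by rewrite -e (brace_act_mem B) in bA.
  - by rewrite e (brace_act_mem B) in aA.
have sPG : P p \subset G by apply: (brace_pre_pcore_sub B).
have acts : [acts P p, on 'O_p(A) | Action act_to'].
  apply/subsetP => g gP; have gG := subsetP sPG g gP.
  rewrite !inE gG; apply/subsetP => a aO; rewrite inE /= /to' gG.
  by rewrite (brace_pcore_sub aO) (brace_act_pcore B).
have := pgroup_fix_mod pre_pcore_pgroup acts.
set F := 'Fix_(_ | _)(_) => eF.
have pO : p %| #|'O_p(A)|.
  have cP : #|P p| = #|'O_p(A)|.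
    exact: brace_pre_card (pcore_sub _ _) (@brace_pcore_stable _ _ _ _ _ _ B _).
  have ntP : P p :!=: 1.
    apply: contraNneq ntO => P1; rewrite -subG1 -P1.
    exact: pcore_sub_Hall (brace_pre_Hall B p).
  by rewrite -cP; have [] := pgroup_pdiv pre_pcore_pgroup ntP.
have pF : p %| #|F| by rewrite /dvdn -eF.
have F1 : 1 \in F.
  rewrite inE group1; apply/afixP => g gP /=; rewrite /to' group1 (subsetP sPG) //=.
  by rewrite (brace_act_one B) // (subsetP sPG).
have : 1 < #|F|.
  by apply: leq_trans (prime_gt1 p_pr) (dvdn_leq _ pF); apply/card_gt0P; exists 1.
rewrite (cardsD1 1) F1 ltnS => /card_gt0P[b].
rewrite in_setD1 in_setI => /and3P[b1 bO /afixP fb].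
exists b; split=> // g gP; have := fb g gP.
by rewrite /= /to' (subsetP sPG) // (brace_pcore_sub bO).
Qed.

(** Let [phi c = b] be the fixed point. For g in P, g c = c g gives [to (phi g) c * b = b * phi g],
    so [c] fixes O_p(A). By [trivP] it also fixes the p'-part, hence lies in the trivial kernel. *)
Lemma core_contradiction : False.
Proof.
have [b [bO nt_b fix_b]] := pre_pcore_fix; have bA := brace_pcore_sub bO.
have [c cG ec] := brace_phiP B bA.
have cP : c \in P p by rewrite (brace_mem_pre_pcore B) cG ec.
have sPG : P p \subset G by apply: (brace_pre_pcore_sub B).
suff : c \in brace_ker G A to.
  by rewrite kerB => /set1P c1; rewrite -ec c1 (brace_phi1 B) eqxx in nt_b.
have fix_c g : g \in P p -> to (phi g) c = phi g.
  move=> gP; have gG := subsetP sPG g gP.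
  have := congr1 phi (centsP pre_pcore_abelian _ gP _ cP).
  rewrite !(brace_cocycle B) // ec fix_b // [RHS](brace_mulC B) ?(brace_phi_mem B) //.
  exact: mulIg.
apply/(brace_kerP B); split=> // a aA.
rewrite -(consttC p a) (brace_actM B) ?groupX // (trivP (brace_constt_mem B p^' aA) cP).
have aO := brace_constt_mem B p aA.
have [g gG eg] := brace_phiP B (brace_pcore_sub aO).
by rewrite -eg fix_c // (brace_mem_pre_pcore B) gG eg.
Qed.

End Final.
End Point.

Lemma faithful_squarefree_trivial x :
  x \in A -> <<orb x>> = A -> squarefree #|G : stab x| -> A :=: 1.
Proof.
move=> xA gen sf; apply/eqP; apply: contraT => ntA.
have ntG : G :!=: 1.
  by rewrite -cardG_gt1 (brace_card B) cardG_gt1.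
have [p p_pr ntO] := solvable_pcore_neq1 (brace_solvable B) ntG.
(* Replacing [x] by [to x g] changes neither the generated group nor the orbit length. *)
have [g gG sP] := pcore_sub_stab_conj xA gen sf p_pr ntO.
have xgA : to x g \in A by apply: (brace_act_mem B).
have geng : <<orb (to x g)>> = A by rewrite (brace_orbit_act B).
have sfg : squarefree #|G : stab (to x g)|.
  by rewrite (brace_stabJ B) // -{1}(conjGid gG) indexJg.
apply: False_ind; apply: (core_contradiction xgA geng sfg p_pr ntO).
exact: pre_pcore_act_triv sP.
Qed.

End Core.

(** In the faithful case A = 1. Otherwise [S] covers A modulo the socle by induction, so each g in
    [G] agrees modulo the kernel with some h such that [phi h] is in [S]; then [to x g = to x h] is
    in [S]. *)
Lemma brace_one_generated (gT aT : finGroupType) (G : {group gT})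
    (A : {group aT}) (phi : gT -> aT) (to : aT -> gT -> aT) :
  brace G A phi to -> one_generated G A phi to.
Proof.
have [n leAn] := ubnP #|A|.
elim: n => // n IHn in gT aT G A phi to leAn * => B x S xA gen sf sSA stS xS.
have [kerB | ntK] := eqVneq (brace_ker G A to : {set gT}) 1.
  have A1 : A :=: 1.
    apply: (faithful_squarefree_trivial B kerB _ xA gen sf) => H T ltT BT.
    exact: IHn (leq_trans ltT leAn) BT.
  by apply/eqP; rewrite eqEsubset sSA A1 sub1G.
set K := brace_ker G A to in ntK *; set I := brace_socle G A phi to.
have BQ := brace_quotient B; rewrite -/K -/I in BQ.
have nKG : K <| G := brace_ker_normal B.
have nIA : I <| A := brace_socle_normal B.
have sA := subsetP sSA.
have nK g : g \in G -> g \in 'N(K) by apply: (subsetP (normal_norm nKG)).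
have nI a : a \in A -> a \in 'N(I) by apply: (subsetP (normal_norm nIA)).
have GP g : g \in G -> coset K g \in G / K by apply: mem_quotient.
have AP a : a \in A -> coset I a \in A / I by apply: mem_quotient.
have SP a : a \in S -> coset I a \in S / I by apply: mem_quotient.
(* Injectivity of [quo_phi] turns a congruence modulo the socle into one modulo the kernel. *)
have lift_S g : g \in G -> coset I (phi g) \in S / I ->
    exists2 h, h \in G & phi h \in S /\ coset K g = coset K h.
  move=> gG /morphimP[s _ sS es]; have [h hG eh] := brace_phiP B (sA _ sS).
  exists h; rewrite // eh; split=> //; apply: (brace_inj BQ); rewrite ?GP //.
  by rewrite !(quo_phiE B) // es eh.
have ltAI : #|A / I| < #|A|.
  apply: ltn_quotient (normal_sub nIA); apply: contraNneq ntK => I1.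
  rewrite -subG1; apply/subsetP => k kK.
  have kG := subsetP (normal_sub nKG) k kK.
  have : phi k \in I by apply/(brace_socleP B); exists k.
  by rewrite I1 !inE (brace_phi_eq1 B).
have eS : S / I = A / I.
  apply: (IHn _ _ _ _ _ _ (leq_trans ltAI leAn) BQ (coset I x) (S / I)%G).
  - exact: AP.
  - have nO := subset_trans (brace_orbit_sub B xA) (normal_norm nIA).
    have := quotient_gen nO; rewrite gen => gI; apply: etrans (esym gI).
    congr <<_>>; apply/setP => d; apply/imsetP/morphimP.
      case=> _ /morphimP[g _ gG ->] ->; exists (to x g); rewrite ?imset_f //.
        by rewrite nI ?(brace_act_mem B).
      by rewrite (quo_actE B).
    case=> _ _ /imsetP[g gG ->] ->; exists (coset K g); rewrite ?GP //.
    by rewrite (quo_actE B).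
  - apply: squarefree_dvdn sf.
    have sDG := brace_stab_sub B xA.
    apply: dvdn_trans (index_quotient_dvdn nKG sDG).
    apply/indexgS/subsetP => _ /morphimP[g _ gD ->].
    move: gD; rewrite (brace_mem_stab B) // => /andP[gG /eqP e].
    by rewrite (brace_mem_stab BQ) ?AP // GP // (quo_actE B) ?e /=.
  - exact: quotientS.
  - move=> _ _ /morphimP[s _ sS ->] /morphimP[g _ gG ->].
    rewrite (quo_phiE B) // => /(lift_S _ gG)[h hG [hS e]]; rewrite [X in quo_act _ X]e.
    by rewrite (quo_actE B) ?sA // SP ?stS.
  - exact: SP.
apply/eqP; rewrite eqEsubset sSA -{1}gen gen_subG.
apply/subsetP => _ /imsetP[g gG ->].
have [|h hG [hS /(rcoset_kercosetP (nK _ gG) (nK _ hG))]] := lift_S _ gG.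
  by rewrite eS AP ?(brace_phi_mem B).
case/rcosetP=> k /(brace_kerP B)[kG fk] ->.
by rewrite (brace_act_mul B) // fk // stS.
Qed.

(** * The brace structure on the permutation group of a solution *)

Section Solution.
Variables (X : finType) (r : X * X -> X * X).
Hypothesis sol : is_solution r.

Local Notation sg := (sig_ r).
Local Notation gm := (gam_ r).

Lemma sig_inj x : injective (sg x).
Proof. by case: sol => _ /(_ x)/bij_inj. Qed.

Lemma gam_inj x : injective (gm x).
Proof. by case: sol => _ _ /(_ x)/bij_inj. Qed.

Lemma solE x y : r (x, y) = (sg x y, gm y x).
Proof. by rewrite /sig_ /gam_; case: (r _). Qed.

Lemma sig_gam x y : sg (sg x y) (gm y x) = x.
Proof. by case: sol => /(_ (x, y)); rewrite !solE => -[]. Qed.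

Lemma sig_sig x y z : sg x (sg y z) = sg (sg x y) (sg (gm y x) z).
Proof.
case: sol => _ _ _ /(_ (x, y, z)).
by rewrite /r12 /r23; do ![rewrite solE /=]; case=> ->.
Qed.

Definition sigp x : {perm X} := perm (@sig_inj x).

Lemma sigpE x y : sigp x y = sg x y.
Proof. exact: permE. Qed.

(** This is Rump's cycle set identity for u·v = σ_u^-1(v), in inverted form; it is the source of
    commutativity of the addition. *)
Lemma sigp_mulC u v :
  sigp ((sigp u)^-1 v) * sigp u = sigp ((sigp v)^-1 u) * sigp v.
Proof.
set w := (sigp u)^-1 v; have ew : sg u w = v by rewrite -sigpE permKV.
have <- : gm w u = (sigp v)^-1 u.
  by apply: (@perm_inj _ (sigp v)); rewrite permKV sigpE -ew sig_gam.
by apply/permP => z; rewrite !permM !sigpE sig_sig ew.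
Qed.

(** For w = σ_u^-1(u), involutivity gives γ_w(u) = w; so two points with the same w have the same
    image under the injective γ_w. *)
Lemma diag_inj : injective (fun u => (sigp u)^-1 u).
Proof.
have gmD u : gm ((sigp u)^-1 u) u = (sigp u)^-1 u.
  set w := (sigp u)^-1 u; have ew : sg u w = u by rewrite -sigpE permKV.
  by apply: (@sig_inj u); rewrite -{1}ew sig_gam ew.
by move=> u v /= e; apply: (@gam_inj ((sigp u)^-1 u)); rewrite gmD e gmD.
Qed.

Definition sol_group : {group {perm X}} := <<perm_gens r>>%G.
Local Notation G := sol_group.

Lemma sigp_mem x : sigp x \in G.
Proof.
apply: mem_gen; rewrite inE; apply/existsP; exists x.
by apply/forallP => y; rewrite sigpE.
Qed.

Lemma perm_gensP p : p \in perm_gens r -> exists x, p = sigp x.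
Proof.
rewrite inE => /existsP[x /forallP px]; exists x.
by apply/permP => y; rewrite sigpE (eqP (px y)).
Qed.

(* h + sigma_x in the brace structure of [G]. *)
Definition add_sig x (h : {perm X}) := if h \in G then sigp (h^-1 x) * h else h.

Lemma add_sig_mem x h : h \in G -> add_sig x h \in G.
Proof. by move=> hG; rewrite /add_sig hG groupM ?sigp_mem. Qed.

Lemma add_sig_out x h : h \notin G -> add_sig x h = h.
Proof. by rewrite /add_sig => /negPf->. Qed.

Lemma add_sig_inj x : injective (add_sig x).
Proof.
move=> h k; have [hG|hG] := boolP (h \in G); have [kG|kG] := boolP (k \in G).
(* Applying the inverses of both sides to [x] gives the diagonal map at [h^-1 x] and at [k^-1 x], so
   these points agree and the σ-factors cancel. *)
- rewrite /add_sig hG kG => e; have := congr1 (fun p : {perm X} => p^-1 x) e.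
  rewrite !invMg !permM => /diag_inj ev.
  by move: e; rewrite ev => /mulgI.
- by move=> e; case/negP: (kG); move: (add_sig_mem x hG); rewrite e add_sig_out.
- by move=> e; case/negP: (hG); move: (add_sig_mem x kG); rewrite -e add_sig_out.
- by rewrite !add_sig_out.
Qed.

Definition add_perm x : {perm {perm X}} := perm (@add_sig_inj x).

Lemma add_permE x h : h \in G -> add_perm x h = sigp (h^-1 x) * h.
Proof. by move=> hG; rewrite permE /add_sig hG. Qed.

Lemma add_perm_out x h : h \notin G -> add_perm x h = h.
Proof. by move=> hG; rewrite permE add_sig_out. Qed.

Lemma add_perm_mem x h : h \in G -> add_perm x h \in G.
Proof. by move=> hG; rewrite permE add_sig_mem. Qed.

(* [add_group] acts regularly on [sol_group] (and fixes everything else), so that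
   evaluation at [1] transports its law to an addition on [sol_group]. *)
Definition add_group : {group {perm {perm X}}} := <<[set add_perm x | x : X]>>%G.
Local Notation A := add_group.

Lemma add_perm_in x : add_perm x \in A.
Proof. by rewrite mem_gen // imset_f. Qed.

(** At [h] in [G], commutation of two generators is [sigp_mulC] for the points [h^-1 x] and
    [h^-1 y]. *)
Lemma add_group_abelian : abelian A.
Proof.
rewrite /add_group /= abelian_gen; apply/centsP => _ /imsetP[x _ ->] _ /imsetP[y _ ->].
apply/permP => h; rewrite !permM.
have [hG|hG] := boolP (h \in G); last by rewrite !add_perm_out.
rewrite !add_permE ?groupM ?sigp_mem // !invMg !permM !mulgA.
by rewrite sigp_mulC.
Qed.

Lemma add_group_mem a h : a \in A -> h \in G -> a h \in G.
Proof.
suff /subsetP sA : A \subset 'N(G | 'P).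
  by move=> /sA aN hG; have := astabs_act h aN; rewrite /= apermE => ->.
rewrite gen_subG; apply/subsetP => _ /imsetP[x _ ->]; rewrite !inE /=.
by apply/subsetP => k kG; rewrite inE /= apermE add_perm_mem.
Qed.

Lemma add_group_out a h : a \in A -> h \notin G -> a h = h.
Proof.
suff /subsetP sA : A \subset 'C(~: G | 'P).
  move=> /sA aC hG; have hC : h \in ~: G by rewrite inE.
  by have := astab_act aC hC; rewrite /= apermE.
rewrite gen_subG; apply/subsetP => _ /imsetP[x _ ->]; rewrite !inE /=.
by apply/subsetP => k; rewrite !inE /= apermE => kG; rewrite add_perm_out.
Qed.

Definition rmul (g : {perm X}) : {perm {perm X}} := perm (mulIg g).

Lemma rmulM g h : rmul (g * h) = rmul g * rmul h.
Proof. by apply/permP => k; rewrite permM !permE mulgA. Qed.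

Lemma rmul1 : rmul 1 = 1.
Proof. by apply/permP => k; rewrite !permE mulg1. Qed.

Lemma rmulJ (a : {perm {perm X}}) g h : (a ^ rmul g) h = a (h * g^-1) * g.
Proof.
have -> : a ^ rmul g = rmul g^-1 * a * rmul g.
  rewrite conjgE mulgA; congr (_ * _ * _); apply: (mulIg (rmul g)).
  by rewrite mulVg -rmulM mulVg rmul1.
by rewrite !permM !permE.
Qed.

(** Conjugation by right translations thus realizes the action of [G] on X inside [A], and will be
    the brace action. *)
Lemma add_permJ x g : g \in G -> add_perm x ^ rmul g = add_perm (g x).
Proof.
move=> gG; apply/permP => h; rewrite rmulJ.
have [hG|hG] := boolP (h \in G); last first.
  by rewrite !add_perm_out ?mulgKV ?groupMr ?groupV.
by rewrite !add_permE ?groupM ?groupV // -mulgA mulgKV invMg invgK permM.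
Qed.

Lemma add_groupJ a g : a \in A -> g \in G -> a ^ rmul g \in A.
Proof.
move=> aA gG; rewrite memJ_norm //; suff : rmul g \in 'N(A) by [].
rewrite inE -genJ genS //; apply/subsetP => _ /imsetP[_ /imsetP[x _ ->] ->].
by rewrite add_permJ // imset_f.
Qed.

(** The values [a 1] in [G] form a subgroup: if [a 1 = h] and [b 1 = k], then [b * a ^ rmul k] sends
    1 to k and then to [h * k]. It contains the generators σ_x. *)
Lemma add_group_onto g : g \in G -> exists2 a, a \in A & a 1 = g.
Proof.
pose O := [set h in G | [exists a in A, a 1 == h]].
have gO : group_set O.
  apply/group_setP; split.
    by rewrite inE group1; apply/exists_inP; exists 1; rewrite ?group1 ?perm1.
  move=> h k; rewrite !inE => /andP[hG /exists_inP[a aA /eqP ah]].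
  move=> /andP[kG /exists_inP[b bA /eqP bk]].
  rewrite groupM //; apply/exists_inP; exists (b * a ^ rmul k).
    by rewrite groupM ?add_groupJ.
  by rewrite permM bk rmulJ mulgV ah.
have sGO : G \subset Group gO.
  rewrite gen_subG; apply/subsetP => _ /perm_gensP[x ->].
  rewrite inE sigp_mem; apply/exists_inP; exists (add_perm x); first exact: add_perm_in.
  by rewrite add_permE // mulg1 invg1 perm1.
by move/(subsetP sGO); rewrite inE => /andP[_ /exists_inP[a aA /eqP]]; exists a.
Qed.

(** An abelian transitive group has trivial point stabilizers. *)
Lemma add_group_regular a b : a \in A -> b \in A -> a 1 = b 1 -> a = b.
Proof.
move=> aA bA e; apply/permP => h.
have [hG|hG] := boolP (h \in G); last by rewrite !add_group_out.
have [c cA <-] := add_group_onto hG.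
rewrite -!permM (centsP add_group_abelian c cA a aA).
by rewrite (centsP add_group_abelian c cA b bA) !permM e.
Qed.

(** The inverse of evaluation at 1; on [G] the default value never occurs. *)
Definition sol_phi g : {perm {perm X}} := odflt 1 [pick a in A | a 1 == g].

Lemma sol_phiP g : g \in G -> sol_phi g \in A /\ sol_phi g 1 = g.
Proof.
move=> gG; rewrite /sol_phi; case: pickP => [a /andP[aA /eqP]|no] //=.
by have [a aA ea] := add_group_onto gG; have := no a; rewrite aA ea eqxx.
Qed.

Lemma sol_phi_eq g a : g \in G -> a \in A -> a 1 = g -> sol_phi g = a.
Proof.
move=> gG aA ag; have [pA p1] := sol_phiP gG.
by apply: add_group_regular; rewrite // p1.
Qed.

Definition sol_act (a : {perm {perm X}}) g := a ^ rmul g.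

Lemma sol_brace : brace G A sol_phi sol_act.
Proof.
split.
- exact: add_group_abelian.
- apply/setP => a; apply/imsetP/idP => [[g gG ->]|aA].
    by have [] := sol_phiP gG.
  have aG : a 1 \in G by apply: add_group_mem.
  by exists (a 1); rewrite // (sol_phi_eq aG aA).
- move=> g h gG hG e; have [_ <-] := sol_phiP gG; rewrite e.
  by have [_ ->] := sol_phiP hG.
- by move=> a g aA gG; apply: add_groupJ.
- by move=> g _ a b _ _; apply: conjMg.
- by move=> a _; rewrite /sol_act rmul1 conjg1.
- by move=> a g h _ _ _; rewrite /sol_act rmulM conjgM.
- move=> g h gG hG; have [gA g1] := sol_phiP gG; have [hA h1] := sol_phiP hG.
  have gJA := add_groupJ gA hG.
  apply: sol_phi_eq; [exact: groupM|exact: groupM|rewrite /sol_act].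
  rewrite (centsP add_group_abelian _ gJA _ hA) permM h1.
  by rewrite rmulJ mulgV g1.
Qed.

Hypothesis trans : indecomposable r.

(** If [g] acts trivially on [A], evaluating [add_perm (g x) = add_perm x] at 1 gives σ_(g x) = σ_x,
    so g = 1: the action is faithful. The orbit of [add_perm x0] generates [A] and its length
    divides |X|. *)
Lemma irretractable_card1 : squarefree #|X| ->
  (forall x y, sg x =1 sg y -> x = y) -> #|X| = 1%N.
Proof.
move=> sfX irr.
have /imsetP[x0 _ orbx0] : [transitive G, on [set: X] | 'P] := trans.
have orbP x : exists2 g, g \in G & x = g x0.
  have : x \in orbit 'P G x0 by rewrite -orbx0 inE.
  by case/imsetP => g gG ->; exists g.
have sigp_irr x y : sigp x = sigp y -> x = y.
  by move=> e; apply: irr => z; rewrite -!sigpE e.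
have ker1 : brace_ker G A sol_act :=: 1.
  apply/trivgP/subsetP => g /(brace_kerP sol_brace)[gG fix_g].
  rewrite inE; apply/eqP/permP => x; rewrite perm1; apply: sigp_irr.
  have := fix_g _ (add_perm_in x); rewrite /sol_act add_permJ // => /permP/(_ 1).
  by rewrite !add_permE // !mulg1 invg1 !perm1.
have orbE : brace_orbit G sol_act (add_perm x0) = [set add_perm x | x : X].
  apply/setP => a; apply/imsetP/imsetP => [[g gG ->]|[x _ ->]].
    by exists (g x0); rewrite // /sol_act add_permJ.
  by have [g gG ->] := orbP x; exists g; rewrite // /sol_act add_permJ.
have A1 : A :=: 1.
  apply: (@faithful_squarefree_trivial _ _ _ _ _ _ sol_brace ker1 _ (add_perm x0)).
  - by move=> H S _ BH; apply: brace_one_generated BH.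
  - exact: add_perm_in.
  - by rewrite orbE.
  apply: squarefree_dvdn sfX; rewrite -cardsT orbx0 card_orbit.
  apply/indexgS/subsetP => g; rewrite !inE /= => /andP[gG].
  rewrite sub1set inE /= apermE => /eqP e.
  by rewrite (brace_mem_stab sol_brace) ?add_perm_in // gG /sol_act add_permJ ?e /=.
have G1 : G :=: 1 by apply: card1_trivg; rewrite (brace_card sol_brace) A1 cards1.
by rewrite -cardsT orbx0 G1 /orbit imset_set1 cards1.
Qed.

End Solution.

(** * Indecomposability in terms of invariant subsets *)

Section Indecomposable.
Variables (X : finType) (r : X * X -> X * X).
Hypothesis sol : is_solution r.

Lemma indecomposable_set (D : {set X}) x :
  indecomposable r -> x \in D ->
  (forall u y, y \in D -> sig_ r u y \in D) -> D = [set: X].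
Proof.
move=> /imsetP[x0 _ orbx0] xD stD; apply/eqP; rewrite eqEsubset subsetT /=.
have aD : [acts sol_group r, on D | 'P].
  rewrite gen_subG; apply/subsetP => _ /(perm_gensP sol)[u ->]; rewrite !inE /=.
  by apply/subsetP => y yD; rewrite inE /= apermE sigpE stD.
have : x \in [set: X] by rewrite inE.
rewrite orbx0 => /orbit_eqP <-.
by rewrite acts_sub_orbit.
Qed.

Lemma set_indecomposable x :
  (forall D : {set X}, x \in D -> (forall u y, y \in D -> sig_ r u y \in D) ->
    D = [set: X]) -> indecomposable r.
Proof.
move=> H; apply/imsetP; exists x; rewrite ?inE //; apply/esym/H.
  exact: orbit_refl.
move=> u _ /imsetP[g gG ->]; apply/imsetP; exists (g * sigp sol u).
  by rewrite groupM // (sigp_mem sol).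
by rewrite /= !apermE permM sigpE.
Qed.

End Indecomposable.

(** * The retraction as an indecomposable solution of order dividing |X| *)

Section Retraction.
Variable S : fsol.
Local Notation X := (car S).
Local Notation r := (@rmap S).
Hypothesis sol : is_solution r.
Local Notation sg := (sig_ r).
Local Notation gm := (gam_ r).
Local Notation sp := (sigp sol).
Local Notation cl := (@cls S).
Local Notation R := (rmap (f := Ret S)).

Lemma cls_eq x y : cl x = cl y <-> sp x = sp y.
Proof.
split=> [[/ffunP e]|e].
  by apply/permP => z; rewrite !sigpE; have := e z; rewrite !ffunE.
by apply: val_inj; apply/ffunP => z; rewrite !ffunE -!(sigpE sol) e.
Qed.

Lemma cls_rep c : cl (rep c) = c.
Proof. by apply: val_inj; exact: eqP (xchooseP (existsP (valP c))). Qed.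

(** By [sigp_mulC], σ of σ_u^-1(x) is determined by u and σ_x alone. *)
Lemma cls_tau u x y : cl x = cl y -> cl ((sp u)^-1 x) = cl ((sp u)^-1 y).
Proof.
move=> /cls_eq e; apply/cls_eq/(mulIg (sp u)).
by rewrite [LHS]sigp_mulC [RHS]sigp_mulC e.
Qed.

(** By finiteness σ_u is a power of its inverse, so [cls_tau] can be iterated. *)
Lemma cls_sig u x y : cl x = cl y -> cl (sg u x) = cl (sg u y).
Proof.
move=> e; rewrite -!(sigpE sol) -[sp u]invgK invg_expg !permX.
by elim: _.-1 => //= k; apply: cls_tau.
Qed.

Lemma cls_sig_inj u x y : cl (sg u x) = cl (sg u y) -> cl x = cl y.
Proof. by move/(cls_tau u); rewrite -!(sigpE sol) !permK. Qed.

Lemma gamE x y : gm y x = (sp (sg x y))^-1 x.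
Proof. by apply: (@perm_inj _ (sp (sg x y))); rewrite permKV sigpE sig_gam. Qed.

Lemma Ret_cls x y : R (cl x, cl y) = (cl (sg x y), cl (gm y x)).
Proof.
have [ex ey] := (cls_rep (cl x), cls_rep (cl y)).
rewrite /= /retmap /= (solE r).
have es : cl (sg (rep (cl x)) (rep (cl y))) = cl (sg x y).
  rewrite (cls_sig _ ey) -!(sigpE sol).
  by move/cls_eq: ex => ->.
rewrite es; congr (_, _); rewrite !gamE.
by move/cls_eq: es => ->; apply: cls_tau.
Qed.

Lemma Ret_sig x y : sig_ R (cl x) (cl y) = cl (sg x y).
Proof. by rewrite /sig_ Ret_cls. Qed.

Lemma Ret_gam x y : gam_ R (cl y) (cl x) = cl (gm y x).
Proof. by rewrite /gam_ Ret_cls. Qed.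

Lemma cls_onto c : exists x, cl x = c.
Proof. by exists (rep c); apply: cls_rep. Qed.

Lemma Ret_solution : is_solution R.
Proof.
split.
- case=> c d; have [[x <-] [y <-]] := (cls_onto c, cls_onto d).
  rewrite !Ret_cls; case: sol => /(_ (x, y)).
  by rewrite !solE => -[-> ->].
- move=> c; have [x <-] := cls_onto c.
  have K : cancel (fun d => cl ((sp x)^-1 (rep d))) (sig_ R (cl x)).
    by move=> d; rewrite Ret_sig -(sigpE sol) permKV cls_rep.
  exact: (bij_can_bij (injF_bij (can_inj K)) K).
- move=> c; have [y <-] := cls_onto c.
  have K : cancel (fun d => cl (invF (@gam_inj _ _ sol y) (rep d))) (gam_ R (cl y)).
    by move=> d; rewrite Ret_gam f_invF cls_rep.
  exact: (bij_can_bij (injF_bij (can_inj K)) K).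
- case=> [[c d] e].
  have [[x <-] [[y <-] [z <-]]] := (cls_onto c, (cls_onto d, cls_onto e)).
  pose F (t : X * X * X) := (cl t.1.1, cl t.1.2, cl t.2).
  have F12 t : r12 R (F t) = F (r12 r t).
    by case: t => [[a b] h]; rewrite /r12 /F Ret_cls (solE r).
  have F23 t : r23 R (F t) = F (r23 r t).
    by case: t => [[a b] h]; rewrite /r23 /F Ret_cls (solE r).
  rewrite -[(_, _, _)]/(F (x, y, z)) !(F12, F23).
  by case: sol => _ _ _ ->.
Qed.

Hypothesis ind : indecomposable r.

Lemma Ret_indecomposable : indecomposable R.
Proof.
have /imsetP[x0 _ _] := ind.
apply: (set_indecomposable Ret_solution (x := cl x0)) => D x0D stD.
apply/setP => c; rewrite inE; have [x <-] := cls_onto c.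
suff : x \in cl @^-1: D by rewrite inE.
rewrite (@indecomposable_set _ _ sol (cl @^-1: D) x0) ?inE // => u y.
by rewrite !inE -Ret_sig; apply: stD.
Qed.

Local Notation fib x := [set z | cl z == cl x].

(** Each σ_u maps fibres of [cls] bijectively onto fibres, and transitivity makes them all equally
    large. *)
Lemma Ret_card x : #|X| = (#|car (Ret S)| * #|fib x|)%N.
Proof.
have fibE u y : #|fib (sg u y)| = #|fib y|.
  rewrite -(card_imset (mem (fib y)) (@perm_inj _ (sp u))).
  apply: eq_card => z; rewrite inE; apply/eqP/imsetP => [e|[w]].
    exists ((sp u)^-1 z); rewrite ?permKV // inE; apply/eqP/(@cls_sig_inj u).
    by rewrite -!(sigpE sol) permKV e sigpE.
  by rewrite inE => /eqP e ->; rewrite sigpE; apply: cls_sig.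
have fibX y : #|fib y| = #|fib x|.
  have : y \in [set z | #|fib z| == #|fib x|].
    have -> // := @indecomposable_set _ _ sol [set z | #|fib z| == #|fib x|] x ind;
      rewrite ?inE // => u z.
    by rewrite !inE fibE.
  by rewrite inE => /eqP.
rewrite -[LHS]sum1_card (partition_big cl predT) //= -sum_nat_const.
apply: eq_bigr => c _; have [y <-] := cls_onto c.
by rewrite -(fibX y) -sum1_card; apply: eq_bigl => z; rewrite inE.
Qed.

End Retraction.

(** * Iterated retraction, and maps onto cyclic permutation solutions *)

Lemma squarefree_multipermutation (S : fsol) :
  is_solution (@rmap S) -> indecomposable (@rmap S) -> squarefree #|car S| ->
  exists k, 0 < k /\ #|car (iter k Ret S)| = 1%N.
Proof.
have [n leSn] := ubnP #|car S|; elim: n => // n IHn in S leSn *.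
move=> sol ind sf; have /imsetP[x0 _ _] := ind.
have [inj|] := boolP (injectiveb (@cls S)).
  (* The level must be positive, so the singleton is retracted once. *)
  exists 1%N; split=> //=; have := Ret_card sol ind x0.
  rewrite (irretractable_card1 sol ind sf) => [/esym/eqP|x y e].
    by rewrite muln_eq1 => /andP[/eqP].
  by apply: (injectiveP _ inj); apply/(cls_eq sol)/permP => z; rewrite !sigpE e.
move=> /injectivePn[x [y neq e]].
have cS := Ret_card sol ind x.
have ltR : #|car (Ret S)| < #|car S|.
  rewrite cS ltn_Pmulr //; last by apply/card_gt0P; exists (cls x).
  rewrite (cardsD1 x) inE eqxx ltnS; apply/card_gt0P; exists y.
  by rewrite !inE e eqxx eq_sym neq.
have [|k [k0 ek]] := IHn (Ret S) (leq_trans ltR leSn) (Ret_solution sol)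
  (Ret_indecomposable sol ind).
  by apply: squarefree_dvdn sf; rewrite cS dvdn_mulr.
by exists k.+1; rewrite iterSr.
Qed.

(** The permutation solution of the p-cycle i -> i + 1: all σ are this cycle and all γ its
    inverse. *)
Definition cycle_sol (p : nat) (t : 'I_p * 'I_p) : 'I_p * 'I_p :=
  (ordS t.2, ord_pred t.1).

Lemma cycle_solution (p : nat) : is_solution (@cycle_sol p).
Proof.
split.
- by case=> a b; rewrite /cycle_sol /= ordSK ord_predK.
- by move=> a; exists (@ord_pred p) => b; rewrite /sig_ /= ?ordSK ?ord_predK.
- by move=> a; exists (@ordS p) => b; rewrite /gam_ /= ?ordSK ?ord_predK.
- by case=> [[a b] c]; rewrite /r12 /r23 /cycle_sol /= ordSK ord_predK.
Qed.

(** The group is cyclic, generated by the common value c of the σ's, and transitivity makes p divide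
    its order. Writing a point as c^k(x0) determines k modulo p, and the map sends the point to this
    residue. *)
Lemma permutation_solution_quotient (X : finType) (r : X * X -> X * X) (p : nat) :
    is_solution r -> indecomposable r -> 0 < p -> p %| #|X| ->
    (forall x y, sig_ r x =1 sig_ r y) ->
  exists f : X -> 'I_p, sol_hom r (@cycle_sol p) f /\ forall v, exists u, f u = v.
Proof.
move=> sol ind p_gt0 pX const; have /imsetP[x0 _ orbx0] := ind.
pose c := sigp sol x0.
have sigc u y : sig_ r u y = c y by rewrite (const u x0) sigpE.
have defG : sol_group r = <[c]> :> {set _}.
  rewrite /sol_group /cycle /=; congr <<_>>; apply/setP => s; rewrite inE.
  apply/idP/set1P => [|->].
    by move=> /existsP[u /forallP su]; apply/permP => y; rewrite (eqP (su y)) sigc.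
  by apply/existsP; exists x0; apply/forallP => y; rewrite sigpE.
have p_c : p %| #[c].
  apply: dvdn_trans pX _; rewrite -cardsT.
  have tr : [transitive sol_group r, on [set: X] | 'P] := ind.
  by have := atrans_dvd tr; rewrite defG.
have exK x : exists k, (c ^+ k) x0 == x.
  have : x \in orbit 'P (sol_group r) x0 by rewrite -orbx0 inE.
  by rewrite defG => /imsetP[_ /cycleP[k ->] ->]; exists k; rewrite /= apermE.
pose K x := xchoose (exK x).
have cK x : (c ^+ K x) x0 = x by apply/eqP/(xchooseP (exK x)).
(* Powers of c agreeing at [x0] agree everywhere, as they commute with the power carrying [x0] to
   any given point. *)
have Keq i j : (c ^+ i) x0 = (c ^+ j) x0 -> i = j %[mod p].
  move=> e; have : c ^+ i == c ^+ j.
    apply/eqP/permP => x; rewrite -(cK x) -!permM.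
    by rewrite -!expgD ![(K x + _)%N]addnC !expgD !permM e.
  by rewrite eq_expg_mod_order => /eqP/(congr1 (modn^~ p)); rewrite !modn_dvdm.
exists (fun x => Ordinal (ltn_pmod (K x) p_gt0)); split=> [u y|v].
  apply: val_inj; rewrite /= sigc -addn1 modnDml addn1; apply: Keq.
  by rewrite cK expgSr permM cK.
exists ((c ^+ v) x0); apply: val_inj => /=.
by rewrite (Keq _ v) ?modn_small // cK.
Qed.

(** * Products of distinct primes and the conclusion *)

Lemma prime_dvd_prod_primes (q : nat) (ps : seq nat) :
  prime q -> all prime ps -> q %| \prod_(p <- ps) p -> q \in ps.
Proof.
move=> q_pr; elim: ps => [|p ps IHps] /=.
  by rewrite big_nil dvdn1 => _ /eqP q1; rewrite q1 in q_pr.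
move=> /andP[p_pr ps_pr]; rewrite big_cons Euclid_dvdM // dvdn_prime2 // inE.
by case/orP=> [->|/(IHps ps_pr)->] //; rewrite orbT.
Qed.

Lemma squarefree_prod_primes (ps : seq nat) :
  all prime ps -> uniq ps -> squarefree (\prod_(p <- ps) p).
Proof.
elim: ps => [|q ps IHps] /=.
  move=> _ _ p /prime_gt1 p_gt1; rewrite big_nil dvdn1 -(exp1n 2) eqn_exp2r //.
  by rewrite neq_ltn p_gt1 orbT.
move=> /andP[q_pr ps_pr] /andP[q_ps ps_uniq] p p_pr; rewrite big_cons.
have [->|neq] := eqVneq p q.
  rewrite expnS expn1 dvdn_pmul2l ?prime_gt0 //.
  exact: contra (prime_dvd_prod_primes q_pr ps_pr) q_ps.
rewrite Gauss_dvdr; first exact: IHps.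
by rewrite coprimeXl // prime_coprime // dvdn_prime2.
Qed.

Local Close Scope group_scope.

Theorem theorem4p5 (n : nat) (ps : seq nat) (X : finType) (r : X * X -> X * X) :
  0 < n -> size ps = n -> all prime ps -> uniq ps ->
  is_solution r -> indecomposable r -> #|X| = \prod_(p <- ps) p ->
  multipermutation r /\ (1 < n -> ~ simple_sol r).
Proof.
move=> n_gt0 size_ps ps_pr ps_uniq sol ind cX.
have sf : squarefree #|X| by rewrite cX; apply: squarefree_prod_primes.
split; first exact: (@squarefree_multipermutation (FSol r)).
move=> n_gt1 [X_gt1 simp].
have solR := @Ret_solution (FSol r) sol.
have homR : sol_hom r (rmap (f := Ret (FSol r))) (@cls (FSol r)).
  by move=> x y; rewrite (@Ret_sig (FSol r) sol).
(* Simplicity is tested on the projection to the retraction: a bijection means irretractable, a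
   one-point image means that all σ coincide. *)
have [bij|/eqP/fintype1P[c cE]] := simp _ _ _ solR homR (@cls_onto (FSol r)).
  have X1 : #|X| = 1%N.
    apply: (irretractable_card1 sol ind sf) => x y e; apply: (bij_inj bij).
    by apply/(@cls_eq (FSol r) sol)/permP => z; rewrite !sigpE e.
  by rewrite X1 in X_gt1.
have const x y : sig_ r x =1 sig_ r y.
  have /(@cls_eq (FSol r) sol) e : @cls (FSol r) x = @cls (FSol r) y.
    by rewrite [LHS]cE [RHS]cE.
  by move=> z; rewrite -!(sigpE sol) e.
case: ps => [|p [|q ps]] in size_ps ps_pr cX ps_uniq *; try by rewrite -size_ps in n_gt1.
move: cX; rewrite !big_cons => cX.
have /and3P[p_pr q_pr _] := ps_pr.
have pX : p %| #|X| by rewrite cX dvdn_mulr.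
(* A bijective [f] would give |X| = p, although a second prime [q] divides |X| / p; a one-point
   target would give p = 1. *)
have [f [homf onto_f]] := permutation_solution_quotient sol ind (prime_gt0 p_pr) pX const.
have [/bij_eq_card|] := simp _ _ f (@cycle_solution p) homf onto_f;
  rewrite card_ord; last first.
  by move=> p1; rewrite p1 in p_pr.
move/eqP; rewrite cX -[X in _ == X]muln1 eqn_pmul2l ?prime_gt0 // muln_eq1.
by case/andP=> /eqP q1; rewrite q1 in q_pr.
Qed.
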